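(* Let $Q$ be a loop. Consider the following three properties: (a) $Q$ is an Osborn loop; (b) $Q$ is a Buchsteiner loop; (c) all squares of $Q$ are in the nucleus, i.e. $x^2\in N(Q)$ for all $x\in Q$. Any two of these properties imply the third property.
   Context: A loop $Q$ is an Osborn loop if for each $x\in Q$ there exists a permutation $\alpha_x$ of $Q$ such that $\alpha_x(y)\cdot(zx)=x((yz)x)$ for all $y,z\in Q$. A loop $Q$ is a Buchsteiner loop if $x\backslash((xy)z)=(y(zx))/x$ for all $x,y,z\in Q$, where $a\backslash b$ is the unique $u$ with $au=b$ and $b/a$ is the unique $v$ with $va=b$. The nucleus is $N(Q)=N_\lambda\cap N_\mu\cap N_\rho$, where $N_\lambda=\{a;\ a(xy)=(ax)y\ \forall x,y\in Q\}$, $N_\mu=\{a;\ x(ay)=(xa)y\ \forall x,y\in Q\}$, $N_\rho=\{a;\ (xy)a=x(ya)\ \forall x,y\in Q\}$. *)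

(* Defs.v *)
From HB Require Import structures.
From mathcomp Require Import all_boot.

Set Implicit Arguments.
Unset Strict Implicit.
Unset Printing Implicit Defensive.

Local Open Scope group_scope.

(* [ldivP] and [rdivP] give both existence and uniqueness: ldiv a b (a \ b) is
   the unique u with a * u = b, and rdiv b a (b / a) is the unique v with
   v * a = b.  The mixin sits on [baseUMagmaType] rather than [umagmaType]
   because the latter would require the carrier to be a choiceType. *)
HB.mixin Record BaseUMagma_isLoop Q of BaseUMagma Q := {
  loop_mul1g : forall x : Q, 1 * x = x;
  loop_mulg1 : forall x : Q, x * 1 = x;
  ldiv : Q -> Q -> Q;
  rdiv : Q -> Q -> Q;
  ldivP : forall a b u : Q, a * u = b <-> u = ldiv a b;
  rdivP : forall a b v : Q, v * a = b <-> v = rdiv b a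
}.

#[short(type="loopType")]
HB.structure Definition Loop := {Q of BaseUMagma_isLoop Q & BaseUMagma Q}.

Bind Scope group_scope with Loop.sort.

Definition osborn (Q : loopType) : Prop :=
  forall x : Q, exists alpha : Q -> Q,
    bijective alpha /\
    forall y z : Q, alpha y * (z * x) = x * ((y * z) * x).

Definition buchsteiner (Q : loopType) : Prop :=
  forall x y z : Q, ldiv x ((x * y) * z) = rdiv (y * (z * x)) x.

Definition left_nucleus (Q : loopType) (a : Q) : Prop :=
  forall x y : Q, a * (x * y) = (a * x) * y.

Definition middle_nucleus (Q : loopType) (a : Q) : Prop :=
  forall x y : Q, x * (a * y) = (x * a) * y.

Definition right_nucleus (Q : loopType) (a : Q) : Prop :=
  forall x y : Q, (x * y) * a = x * (y * a).

Definition nucleus (Q : loopType) (a : Q) : Prop :=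
  [/\ left_nucleus a, middle_nucleus a & right_nucleus a].

Definition nuclear_squares (Q : loopType) : Prop :=
  forall x : Q, nucleus (x ^+ 2).

(* Main.v *)
Require Import Defs.
From mathcomp Require Import all_boot.

(** An autotopism of [Q] is a triple of bijections [(f, g, h)] such that
    [f y * g z = h (y * z)].  Write [L_x], [R_x] for the translations.  Both
    loop laws provide, for each [x], an autotopism with middle component [R_x]:
    - Osborn: [(alpha_x, R_x, L_x R_x)], where [alpha_x 1 = x];
    - Buchsteiner: [(L_x^-1, R_x, R_x L_x^-1)].
    An autotopism [(f, id, h)] is always [(L_n, id, L_n)] with [n = f 1] in the
    left nucleus ([principal_left_nucleus]).  Hence conjugating [(L_a, id, L_a)],
    for [a] left nuclear, by either of the above gives a triple of the same kind,
    so that left nuclear elements can be moved across [x]: [x * a = b * x]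
    ([osborn_left_nucleus_conj]) or [a * x = x * b]
    ([buchsteiner_left_nucleus_conj]), with [b] left nuclear.

    The element relating the two laws is [n = alpha_x x], for which
    [n * (u * x) = x * ((x * u) * x)], and in particular [n * x = x * x ^+ 2]
    ([osborn_diag]).  By the last equation, conjugation carries left nuclearity
    from [x ^+ 2] to [n] in an Osborn loop, and from [n] to [x ^+ 2] in a
    Buchsteiner loop.
    - Under both laws, the quotient of the two autotopisms is
      [(alpha_x L_x, id, _)], so [n = alpha_x (x * 1)] is left nuclear, and then
      so is [x ^+ 2].  In a Buchsteiner loop the left nucleus is the nucleus.
    - In an Osborn loop with nuclear squares, [n] is left nuclear.  Cancelling
      [n] in the Osborn law leaves the Buchsteiner law.
    - In a Buchsteiner loop with nuclear squares, [n] is recovered as the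
      conjugate [x \ (x ^+ 2 * x)], and [y |-> n * (x \ y)] serves as
      [alpha_x]. *)

Set Implicit Arguments.
Unset Strict Implicit.
Unset Printing Implicit Defensive.

Local Open Scope group_scope.

Section LoopTheory.

Variable Q : loopType.
Implicit Types a b n p q u x y z : Q.

Lemma mul_ldiv a b : a * ldiv a b = b.
Proof. exact/ldivP. Qed.

Lemma ldiv_mul a b : ldiv a (a * b) = b.
Proof. exact/esym/ldivP. Qed.

Lemma mul_rdiv a b : rdiv b a * a = b.
Proof. exact/rdivP. Qed.

Lemma rdiv_mul a b : rdiv (b * a) a = b.
Proof. exact/esym/rdivP. Qed.

Lemma loop_mulgI a : injective (fun y => a * y).
Proof. exact: can_inj (ldiv_mul a). Qed.

Lemma loop_mulIg a : injective (fun y => y * a).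
Proof. exact: (can_inj (g := rdiv^~ a) (rdiv_mul a)). Qed.

(** The left nucleus consists of the [f 1] for [(f, id, h)] an autotopism:
    setting [q = 1] gives [f = h], and setting [p = 1] gives [h = L_(f 1)]. *)
Lemma principal_left_nucleus (f h : Q -> Q) :
    (forall p q, f p * q = h (p * q)) ->
  left_nucleus (f 1) /\ forall p, h p = f 1 * p.
Proof.
move=> fh; have hE p : h p = f 1 * p by rewrite fh loop_mul1g.
by split=> // p q; rewrite -!hE -fh -[p in RHS]loop_mulg1 -fh loop_mulg1.
Qed.

(** The case [y = x] of the Osborn law, with [alpha_x x] characterised by its
    value at [z = 1]. *)
Lemma osborn_diag x n : osborn Q -> n * x = x * (x * x) ->
  forall u, n * (u * x) = x * ((x * u) * x).
Proof.
move=> /(_ x) [f [_ fE]] nx u; rewrite -fE; congr (_ * _).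
by apply: (@loop_mulIg x); rewrite /= nx -[X in f x * X]loop_mul1g fE loop_mulg1.
Qed.

(** Conjugation of [(L_a, id, L_a)] by the Osborn autotopism; in the third
    component [R_x] drops out because it commutes with [L_a]. *)
Lemma osborn_left_nucleus_conj a x : osborn Q -> left_nucleus a ->
  left_nucleus (rdiv (x * a) x).
Proof.
move=> /(_ x) [f [[g fK gK] fE]] aN.
pose k p := f (a * g p); pose h w := x * (a * ldiv x w).
have khE p q : k p * q = h (p * q).
  by rewrite /k /h -{2}[p]gK -[q](mul_rdiv x) !fE ldiv_mul -!aN.
have [bN hE] := principal_left_nucleus khE.
have := hE x; rewrite /h -[X in ldiv x X]loop_mulg1 ldiv_mul loop_mulg1 => ->.
by rewrite rdiv_mul.
Qed.

(** The autotopism form of the Buchsteiner law. *)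
Lemma buchsteinerP : buchsteiner Q <->
  forall x y z, ldiv x y * (z * x) = ldiv x (y * z) * x.
Proof.
split=> bQ x y z; first by rewrite -{2}[y](mul_ldiv x) bQ mul_rdiv.
by rewrite -[y in RHS](ldiv_mul x) bQ rdiv_mul.
Qed.

(** Conjugation of [(L_a, id, L_a)] by the Buchsteiner autotopism, whose
    first component [L_x^-1] makes [a] move to the other side of [x].  The
    equation says that [L_x^-1 L_a L_x] is again a left translation. *)
Lemma buchsteiner_left_nucleus_conj a x : buchsteiner Q -> left_nucleus a ->
  let b := ldiv x (a * x) in
  left_nucleus b /\ forall y, ldiv x (a * y) = b * ldiv x y.
Proof.
move=> /buchsteinerP bQ aN.
pose f p := ldiv x (a * (x * p)); pose h w := f (rdiv w x) * x.
have fhE p q : f p * q = h (p * q).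
  rewrite /h -[q](mul_rdiv x) -{2}[p](ldiv_mul x) !bQ rdiv_mul.
  by rewrite /f mul_ldiv -aN.
have [bN hE] := principal_left_nucleus fhE.
rewrite /f loop_mulg1 in bN hE; split=> // y.
by rewrite -hE -[X in h X]loop_mulg1 -fhE /f mul_ldiv loop_mulg1.
Qed.

(** Both remaining nuclear laws are instances of the Buchsteiner law: put [a] in
    the place of [y] for the middle one, and in the place of [x] for the right
    one. *)
Lemma buchsteiner_left_nucleus a : buchsteiner Q -> left_nucleus a -> nucleus a.
Proof.
move=> bQ aN; split=> // y z.
  by rewrite -[RHS](mul_ldiv y) bQ aN rdiv_mul.
by rewrite -[RHS](mul_rdiv a) -bQ -aN ldiv_mul.
Qed.

Lemma osborn_buchsteiner_nuclear_squares :
  osborn Q -> buchsteiner Q -> nuclear_squares Q.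
Proof.
move=> oQ bQ x; apply: buchsteiner_left_nucleus => //.
pose n := rdiv (x * (x * x)) x.
have nx : n * x = x * (x * x) := mul_rdiv x _.
have nE := osborn_diag oQ nx.
have [f [_ fE]] := oQ x.
(* The quotient of the Osborn and Buchsteiner autotopisms of [x]. *)
pose g p := f (x * p).
have gnE p q : g p * q = n * (p * q).
  by rewrite /g -[q](mul_rdiv x) fE -[_ * rdiv q x](mul_ldiv x) -nE bQ mul_rdiv.
have [nN hE] := principal_left_nucleus gnE.
have gn : g 1 = n by rewrite -[LHS]loop_mulg1 -hE loop_mulg1.
rewrite gn in nN.
have [] := buchsteiner_left_nucleus_conj x bQ nN.
by rewrite nx ldiv_mul.
Qed.

Lemma osborn_nuclear_squares_buchsteiner :
  osborn Q -> nuclear_squares Q -> buchsteiner Q.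
Proof.
move=> oQ sQ; apply/buchsteinerP => x y z.
pose n := rdiv (x * (x * x)) x.
have nE := osborn_diag oQ (mul_rdiv x _ : n * x = _).
have nN : left_nucleus n by apply: osborn_left_nucleus_conj => //; case: (sQ x).
have [f [_ fE]] := oQ x.
have fn : f y = n * ldiv x y.
  apply: (@loop_mulIg x); rewrite /= -nN nE mul_ldiv.
  by rewrite -[X in f y * X]loop_mul1g fE loop_mulg1.
by apply: (@loop_mulgI n); rewrite /= nN -fn fE nE mul_ldiv.
Qed.

Lemma buchsteiner_nuclear_squares_osborn :
  buchsteiner Q -> nuclear_squares Q -> osborn Q.
Proof.
move=> bQ sQ x; have [sN _ _] := sQ x.
have [] := buchsteiner_left_nucleus_conj x bQ sN.
set n := ldiv x _ => nN nE.
exists (fun y => n * ldiv x y); split.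
  exists (fun w => x * ldiv n w) => y; first by rewrite ldiv_mul mul_ldiv.
  by rewrite ldiv_mul mul_ldiv.
move=> y z; have /buchsteinerP bQ' := bQ.
(* The case [y = x] of the Buchsteiner law turns [x ^+ 2] into the outer
   multiplications by [x] of the Osborn law. *)
by rewrite -nN bQ' nN -nE bQ mul_rdiv.
Qed.

End LoopTheory.

Theorem theorem4p1 (Q : loopType) :
  [/\ osborn Q -> buchsteiner Q -> nuclear_squares Q,
      osborn Q -> nuclear_squares Q -> buchsteiner Q
    & buchsteiner Q -> nuclear_squares Q -> osborn Q].
Proof.
split.
- exact: osborn_buchsteiner_nuclear_squares.
- exact: osborn_nuclear_squares_buchsteiner.
- exact: buchsteiner_nuclear_squares_osborn.
Qed.
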